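(* Let $\{v_1,\ldots,v_n\}$ be a basis of $\mathbb{R}^n$ and let $C=\mathbb{R}_{\geq 0}\cdot v_1+\cdots+\mathbb{R}_{\geq 0}\cdot v_n$ be the corresponding positive convex cone. Define the dual basis $\{v_1',\ldots,v_n'\}$ by $(v_i',v_j)=\delta_{ij}$ $(i,j=1,\ldots,n)$. Let $\mu\in\mathcal{M}^*$ be supported in $C$. For $j=1,\ldots,n$ and $m=0,1,2,\ldots$ define $$s_j(m)=\int_C (v_j',x)^m\,d\mu(x),$$ and suppose that each of the sequences $\{s_j(m)\}_{m=1}^\infty$ ($j=1,\ldots,n$) satisfies $$\sum_{m=1}^\infty\frac{1}{s_j(m)^{1/(2m)}}=\infty.$$ Then $\mu$ is $C$-determinate.
   Context: $(\cdot,\cdot)$ is the standard inner product on $\mathbb{R}^n$ with norm $\Vert\cdot\Vert$. $\mathcal{M}^*$ is the set of all positive Borel measures $\mu$ on $\mathbb{R}^n$ such that $\int_{\mathbb{R}^n}\Vert x\Vert^d\,d\mu(x)<\infty$ for all $d\ge 0$. A measure $\mu\in\mathcal{M}^*$ supported in $C$ is $C$-determinate if every $\nu\in\mathcal{M}^*$ which is also supported in $C$ and satisfies $\int_C P\,d\nu=\int_C P\,d\mu$ for all polynomials $P$ on $\mathbb{R}^n$ is equal to $\mu$. In the series, $1/0$ is read as $+\infty$. *)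

(* Defs.v *)
From HB Require Import structures.
From mathcomp Require Import all_boot all_order all_algebra.
From mathcomp Require mpoly.
From mathcomp Require Import all_classical all_reals all_analysis.
Set Implicit Arguments.
Unset Strict Implicit.
Unset Printing Implicit Defensive.
Import Order.TTheory GRing.Theory Num.Theory.
Import numFieldNormedType.Exports.
Local Open Scope classical_set_scope.
Local Open Scope ring_scope.

(* R^n with its Borel sigma-algebra, generated by the open sets of the
   product topology carried by 'rV[R]_n. *)
Definition borel_rV (R : realType) (n : nat) :=
  g_sigma_algebraType (@open 'rV[R]_n).

Definition dotv (R : realType) (n : nat) (x y : 'rV[R]_n) : R :=
  \sum_(i < n) x 0 i * y 0 i.

(* The Euclidean norm; the library norm `|x| on 'rV[R]_n is the sup norm. *)
Definition enorm (R : realType) (n : nat) (x : 'rV[R]_n) : R :=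
  Num.sqrt (dotv x x).

Definition mpoly_fun (R : realType) (n : nat) (P : mpoly.mpoly n R)
    (x : 'rV[R]_n) : R :=
  mpoly.meval (fun i => x 0 i) P.

Definition finite_moments (R : realType) (n : nat)
    (mu : {measure set (borel_rV R n) -> \bar R}) : Prop :=
  forall d : R, 0 <= d ->
    (\int[mu]_(x in [set: borel_rV R n]) (enorm x `^ d)%:E < +oo)%E.

(* Stated with negligibility so that it makes sense for every set C; for
   Borel C it says mu (~` C) = 0. *)
Definition supported_in (R : realType) (n : nat)
    (mu : {measure set (borel_rV R n) -> \bar R})
    (C : set (borel_rV R n)) : Prop :=
  mu.-negligible (~` C).

(* Measures are functions on all sets in the library, hence equality of
   measures is equality on measurable sets. *)
Definition determinate_on (R : realType) (n : nat) (C : set (borel_rV R n))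
    (mu : {measure set (borel_rV R n) -> \bar R}) : Prop :=
  forall nu : {measure set (borel_rV R n) -> \bar R},
    finite_moments nu -> supported_in nu C ->
    (forall P : mpoly.mpoly n R,
      (\int[nu]_(x in C) (mpoly_fun P x)%:E =
       \int[mu]_(x in C) (mpoly_fun P x)%:E)%E) ->
    forall A : set (borel_rV R n), measurable A -> nu A = mu A.

Definition positive_cone (R : realType) (n : nat)
    (v : n.-tuple 'rV[R]_n) : set (borel_rV R n) :=
  [set x | exists c : 'I_n -> R,
    (forall i, 0 <= c i) /\ x = \sum_(i < n) c i *: tnth v i].

Definition dual_moment (R : realType) (n : nat) (C : set (borel_rV R n))
    (mu : {measure set (borel_rV R n) -> \bar R}) (w : 'rV[R]_n) (m : nat)
    : \bar R :=
  (\int[mu]_(x in C) (dotv w x ^+ m)%:E)%E.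

(* Main.v *)
(* Let y_j = (v_j', x), so that the cone is {y_1, ..., y_n >= 0}.  The
   coordinates are treated one at a time: in the equality of the integrals of
   a product of monomials against mu and nu, each factor y_j ^ m is replaced
   by the indicator of y_j > a.  For the remaining factor G the functions
   xi |-> int G cos(xi sqrt(y_j)) d mu and d nu have the same derivatives at 0,
   and by Cauchy-Schwarz their k-th derivatives are O(s_j(k)^(1/2)), a
   log-convex sequence which by Carleman's inequality satisfies the
   Denjoy-Carleman condition; Bang's argument shows that they coincide.  From
   cos(xi sqrt y) one reaches exp(- c y) through powers of cosines, and then
   the indicator of y > a through powers of 1 - exp(- c y).  The boxes
   {y_j > a_j for all j} form a pi-system that generates the Borel sets. *)
Require Import Defs.
From HB Require Import structures.
From mathcomp Require Import all_boot all_order all_algebra.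
From mathcomp Require Import ring lra zify.
From mathcomp Require Import all_classical all_reals all_analysis.
From mathcomp Require Import measurable_realfun.
From mathcomp Require Import (canonicals) mpoly.
Set Implicit Arguments.
Unset Strict Implicit.
Unset Printing Implicit Defensive.
Import Order.TTheory GRing.Theory Num.Theory.
Import numFieldNormedType.Exports.
Local Open Scope classical_set_scope.
Local Open Scope ring_scope.

(** * Bang's quasi-analyticity argument *)

Lemma sum_halves_le2 (R : realType) (n : nat) :
  \sum_(i < n) (2^-1 : R) ^+ i <= 2.
Proof.
have -> : \sum_(i < n) (2^-1 : R) ^+ i = 2 - 2 * 2^-1 ^+ n.
  elim: n => [|n IHn]; first by rewrite big_ord0 expr0 mulr1 subrr.
  by rewrite big_ord_recr/= IHn exprS; field.
by rewrite lerBlDr lerDl mulr_ge0// exprn_ge0.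
Qed.

Lemma exprn_archi_half (R : realType) (a b : R) : 0 <= a -> 0 < b ->
  exists K : nat, a < 2 ^+ K * b.
Proof.
move=> a0 b0; exists (Num.bound (a / b)); rewrite -ltr_pdivrMr//.
have /lt_le_trans : a / b < (Num.bound (a / b))%:R.
  by apply: archi_boundP; rewrite divr_ge0// ltW.
by apply; rewrite -natrX ler_nat ltnW// ltn_expl.
Qed.

Section bang.
Variables (R : realType) (M : nat -> R).
Hypothesis M_gt0 : forall k, 0 < M k.
Hypothesis M_cvx : forall k, M k.+1 ^+ 2 <= M k * M k.+2.

Lemma logconvex_ratio_nonincr (j k : nat) : (j <= k)%N ->
  M k / M k.+1 <= M j / M j.+1.
Proof.
elim: k => [|k IHk]; first by rewrite leqn0 => /eqP ->.
rewrite leq_eqVlt => /predU1P[->//|/IHk]; apply: le_trans.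
by rewrite ler_pdivrMr// mulrAC ler_pdivlMr// -expr2.
Qed.

(** By log-convexity the ratio [M N / M N.+1] is the smallest of those with index at most [N], so
    each of the [i] steps from [M (j + i)] down to [M j] gains at least this factor. *)
Lemma logconvex_shift (N j i : nat) : (j + i <= N.+1)%N ->
  (M N / M N.+1) ^+ i * M (j + i)%N <= M j.
Proof.
elim: i => [|i IHi]; first by rewrite expr0 mul1r addn0.
rewrite addnS ltnS => jiN; apply: le_trans (IHi _); last by rewrite ltnW.
rewrite exprSr -mulrA; apply: ler_wpM2l.
  by rewrite exprn_ge0 ?divr_ge0 ?(ltW (M_gt0 _)).
by rewrite -ler_pdivlMr ?M_gt0 ?logconvex_ratio_nonincr.
Qed.

(** [g j] plays the role of the [j]-th derivative of [g 0]. Only a size bound and a Taylor estimate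
    are assumed, the latter with its factorials dropped, so no differentiability enters. *)
Variables (C : R) (g : nat -> R -> R).
Hypothesis C_ge0 : 0 <= C.
Hypothesis g_le : forall j x, 0 <= x -> `|g j x| <= C * M j.
Hypothesis g_taylor : forall j n x h, 0 <= x -> 0 <= h ->
  `|g j (x + h)| <= \sum_(i < n) h ^+ i * `|g (j + i)%N x|
                    + h ^+ n * (C * M (j + n)%N).

(* The condition on [x] that the Bang degree of [g] at [x] be at least [K]. *)
Let flat (K : nat) (x : R) :=
  forall j, `|g j x| <= C * (2 ^+ j / 2 ^+ K) * M j.

(** For [j < N], expand to order [N.+1 - j]. Log-convexity turns [h ^+ i * M (j + i)] into at most
    [4^-1 ^+ i * M j], while flatness at [x] costs [2 ^+ i]; the resulting geometric series sums to
    at most 2, which costs exactly one degree. For [j >= N] the a priori bound on [g j] suffices. *)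
Lemma flat_step (N : nat) (x h : R) : 0 <= x -> 0 <= h ->
  h <= M N / M N.+1 / 4 -> flat N.+1 x -> flat N (x + h).
Proof.
move=> x0 h0 hN fx j.
have [Nj|jN] := leqP N j.
  apply: le_trans (g_le _ (addr_ge0 x0 h0)) _.
  rewrite ler_wpM2r ?(ltW (M_gt0 _))// ler_peMr//.
  by rewrite ler_pdivlMr ?exprn_gt0// mul1r ler_weXn2l// ler1n.
have jN1 : (j + (N.+1 - j) = N.+1)%N by rewrite subnKC// ltnW// ltnS ltnW.
apply: le_trans (g_taylor j (N.+1 - j) x0 h0) _.
have hM i : (j + i <= N.+1)%N -> h ^+ i * M (j + i)%N <= 4^-1 ^+ i * M j.
  move=> jiN; apply: le_trans (ler_wpM2l _ (logconvex_shift jiN)).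
    rewrite mulrA -exprMn [4^-1 * _]mulrC ler_wpM2r ?(ltW (M_gt0 _))//.
    by rewrite lerXn2r// nnegrE ?divr_ge0 ?(ltW (M_gt0 _)).
  by rewrite exprn_ge0.
have term i : (j + i <= N.+1)%N ->
    h ^+ i * (C * (2 ^+ (j + i) / 2 ^+ N.+1) * M (j + i)%N) <=
    C * (2 ^+ j / 2 ^+ N.+1) * M j * 2^-1 ^+ i.
  move=> jiN.
  have -> : h ^+ i * (C * (2 ^+ (j + i) / 2 ^+ N.+1) * M (j + i)%N) =
      C * (2 ^+ (j + i) / 2 ^+ N.+1) * (h ^+ i * M (j + i)%N) by ring.
  have -> : C * (2 ^+ j / 2 ^+ N.+1) * M j * 2^-1 ^+ i =
      C * (2 ^+ (j + i) / 2 ^+ N.+1) * (4^-1 ^+ i * M j).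
    have -> : (2^-1 : R) ^+ i = 2 ^+ i * 4^-1 ^+ i.
      by rewrite -exprMn; congr (_ ^+ _); field.
    by rewrite exprD; ring.
  by rewrite ler_wpM2l ?hM// mulr_ge0// divr_ge0// exprn_ge0.
pose A := C * (2 ^+ j / 2 ^+ N.+1) * M j.
have A_ge0 : 0 <= A.
  by rewrite /A !mulr_ge0 ?invr_ge0 ?exprn_ge0 ?(ltW (M_gt0 _)).
apply: (@le_trans _ _ (\sum_(i < (N.+1 - j).+1) A * 2^-1 ^+ i)).
  rewrite big_ord_recr/=; apply: lerD.
    apply: ler_sum => i _; apply: le_trans (term i _).
      by rewrite ler_wpM2l ?exprn_ge0.
    by rewrite -[leqRHS]jN1 leq_add2l ltnW.
  (* The remainder is the term of index [i = N.+1 - j]: there the factor [2 ^+ (j + i) / 2 ^+ N.+1]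
     is 1, and the bound [C * M] has the same form as the others. *)
  apply: le_trans (term (N.+1 - j)%N _); last by rewrite jN1.
  by rewrite jN1 divff ?mulr1// expf_neq0.
rewrite -mulr_sumr; apply: le_trans (ler_wpM2l A_ge0 (sum_halves_le2 _ _)) _.
rewrite le_eqVlt; apply/orP; left; apply/eqP.
by rewrite /A exprS; field; rewrite expf_neq0.
Qed.

(** Walk from 0, where every degree is available, to [x] in steps of length at most
    [M k / M k.+1 / 4] with [k] decreasing to [K]; each step lowers the degree by one. *)
Lemma flat_sum (N K : nat) (x : R) : (forall j, g j 0 = 0) -> 0 <= x ->
  x <= \sum_(K <= k < K + N) M k / M k.+1 / 4 -> flat K x.
Proof.
move=> g0; elim: N K x => [|N IHN] K x x0.
  rewrite addn0 big_geq// => x0'.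
  have -> : x = 0 by apply: le_anti; rewrite x0'.
  by move=> j; rewrite g0 normr0 !mulr_ge0 ?invr_ge0 ?exprn_ge0 ?(ltW (M_gt0 _)).
rewrite big_ltn ?addnS ?ltnS ?leq_addr// -addSn.
set S := \sum_(_ <= _ < _) _ => xS.
have S0 : 0 <= S.
  by apply: sumr_ge0 => k _; rewrite !divr_ge0 ?(ltW (M_gt0 _)).
(* If [x] is already within reach of the remaining steps, the last step has length 0. *)
have [xleS|Sltx] := leP x S.
  rewrite -[x]addr0; apply: flat_step => //; last exact: IHN.
  by rewrite !divr_ge0 ?(ltW (M_gt0 _)).
have -> : x = S + (x - S) by ring.
apply: flat_step => //; first by rewrite subr_ge0 ltW.
- by rewrite lerBlDr.
- exact: IHN.
Qed.

(** Divergence of the series puts [x] within reach of 0 for every final degree [K]; letting [K] grow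
    in the bound for [j = 0] gives [g 0 x = 0]. *)
Lemma bang_quasianalytic :
  (forall B, exists N, B <= \sum_(0 <= k < N) M k / M k.+1) ->
  (forall j, g j 0 = 0) -> forall x, 0 <= x -> g 0 x = 0.
Proof.
move=> Mdvg g0 x x0.
have flx K : flat K x.
  (* The terms from [K] to [N] then sum to at least [4 * x]; the 4 is the divisor of the step
     lengths. *)
  have [N hN] := Mdvg (\sum_(0 <= k < K) M k / M k.+1 + 4 * x).
  have KN : (K <= N)%N \/ (N < K)%N by case: leqP; [left|right].
  have u0 k : 0 <= M k / M k.+1 by rewrite divr_ge0 ?(ltW (M_gt0 _)).
  apply: (@flat_sum (N - K)) => //.
  rewrite -mulr_suml ler_pdivlMr// mulrC.
  case: KN => KN; last first.
    move: hN; rewrite (big_cat_nat (leq0n N) (ltnW KN))/= => hN.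
    have : 0 <= \sum_(N <= k < K) M k / M k.+1 by apply: sumr_ge0.
    have : 0 <= \sum_(K <= k < K + (N - K)) M k / M k.+1 by apply: sumr_ge0.
    by move: hN; lra.
  by rewrite subnKC//; move: hN; rewrite (big_cat_nat (leq0n K) KN)/= lerD2l.
have CM0 : 0 <= C * M 0%N by rewrite mulr_ge0// ltW.
apply/eqP; rewrite -normr_le0 leNgt; apply/negP => gx0.
have [K hK] := exprn_archi_half CM0 gx0.
have := flx K 0%N; rewrite expr0 mul1r mulrAC leNgt => /negP; apply.
by rewrite ltr_pdivrMr ?exprn_gt0// [ltRHS]mulrC.
Qed.

End bang.

(** * Carleman's inequality and the Denjoy-Carleman condition *)

(* The weights [c i] satisfy
   [c 0 * ... * c k = (k + 2) ^ k.+1] and [c i / i.+1 <= e], so that AM-GM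
   applied to [c i * a i] and an Abel summation give the bound. *)
Lemma carleman_inequality (R : realType) (a b : nat -> R) (n : nat) :
  (forall i, 0 <= a i) -> (forall k, 0 <= b k) ->
  (forall k, b k ^+ k.+1 = \prod_(i < k.+1) a i) ->
  \sum_(0 <= k < n) b k <= expR 1 * \sum_(0 <= i < n) a i.
Proof.
move=> a0 b0 ba.
pose c (i : nat) : R := i.+2%:R ^+ i.+1 / i.+1%:R ^+ i.
have c0 i : 0 <= c i by rewrite divr_ge0// exprn_ge0.
have prodc k : \prod_(i < k) c i = k.+1%:R ^+ k.
  elim: k => [|k IHk]; first by rewrite big_ord0 expr0.
  by rewrite big_ord_recr/= IHk /c mulrC divfK// expf_neq0// pnatr_eq0.
pose S k := \sum_(0 <= i < k) c i * a i.
have bS k : b k <= S k.+1 / (k.+1%:R * k.+2%:R).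
  rewrite invfM mulrA ler_pdivlMr ?ltr0n//.
  rewrite -(@ler_pXn2r _ k.+1)// ?nnegrE; last 2 first.
  - by rewrite mulr_ge0.
  - by rewrite divr_ge0// sumr_ge0// => i _; rewrite mulr_ge0.
  rewrite exprMn ba -prodc -big_split/=.
  have [] := @leif_AGM R 'I_k.+1 predT (fun i => a i * c i).
    by move=> i _; rewrite mulr_ge0.
  rewrite card_ord => + _; rewrite /S big_mkord.
  rewrite (eq_bigl (fun=> true))// [in leRHS](eq_bigl (fun=> true))//.
  by under [in leRHS]eq_bigr do rewrite mulrC.
apply: (@le_trans _ _ (\sum_(0 <= i < n) c i * a i / i.+1%:R)); last first.
  rewrite mulr_sumr; apply: ler_sum => i _.
  rewrite mulrAC ler_wpM2r//.
  have -> : c i / i.+1%:R = (1 + i.+1%:R^-1) ^+ i.+1.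
    rewrite /c -mulrA -invfM -exprSr -expr_div_n; congr (_ ^+ _).
    by rewrite -[i.+2%:R]natr1 mulrDl divff ?pnatr_eq0// div1r.
  rewrite -[leRHS](_ : expR i.+1%:R^-1 ^+ i.+1 = _).
    by rewrite lerXn2r ?nnegrE ?expR_ge1Dx ?addr_ge0 ?expR_ge0.
  by rewrite -expRM_natl divff// pnatr_eq0.
(* The summation by parts rests on 1/((k+1)(k+2)) = 1/(k+1) - 1/(k+2). *)
have abel m : \sum_(0 <= k < m) S k.+1 / (k.+1%:R * k.+2%:R) + S m / m.+1%:R =
    \sum_(0 <= i < m) c i * a i / i.+1%:R.
  elim: m => [|m IHm]; first by rewrite !big_geq// /S big_geq// mul0r addr0.
  rewrite !big_nat_recr//= -IHm -addrA -[RHS]addrA; congr (_ + _).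
  have -> : S m.+1 = S m + c m * a m by rewrite /S big_nat_recr.
  have m1 : m.+1%:R != 0 :> R by rewrite pnatr_eq0.
  have m2 : m.+2%:R != 0 :> R by rewrite pnatr_eq0.
  have E : m.+2%:R = m.+1%:R + 1 :> R by rewrite natr1.
  by rewrite E in m2 *; field; apply/andP.
rewrite -abel; apply: (@le_trans _ _ (\sum_(0 <= k < n) S k.+1 / (k.+1%:R * k.+2%:R))).
  exact: ler_sum.
by rewrite lerDl divr_ge0// sumr_ge0// => i _; rewrite mulr_ge0.
Qed.

(* Truncating the moments below at [1] keeps log-convexity and the Carleman
   condition, and removes the degenerate case of vanishing moments. *)
Definition carleman_weight (R : realType) (s : nat -> R) (k : nat) : R :=
  Num.sqrt (Num.max (s k) 1).

Section carleman_weight.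
Variables (R : realType) (s : nat -> R).
Hypothesis s_ge0 : forall k, 0 <= s k.
Hypothesis s_cvx : forall k, s k.+1 ^+ 2 <= s k * s k.+2.
Let M := carleman_weight s.

Lemma carleman_weight_ge1 k : 1 <= M k.
Proof. by rewrite /M /carleman_weight -[leLHS]sqrtr1 ler_wsqrtr// le_max lexx orbT. Qed.

Lemma carleman_weight_gt0 k : 0 < M k.
Proof. exact: lt_le_trans (carleman_weight_ge1 k). Qed.

Lemma sqr_carleman_weight k : M k ^+ 2 = Num.max (s k) 1.
Proof. by rewrite sqr_sqrtr// le_max ler01 orbT. Qed.

(** The maximum of two log-convex sequences, here [s] and the constant 1, is log-convex. *)
Lemma carleman_weight_cvx k : M k.+1 ^+ 2 <= M k * M k.+2.
Proof.
rewrite -(@ler_pXn2r _ 2)// ?nnegrE ?exprn_ge0 ?mulr_ge0 ?(ltW (carleman_weight_gt0 _))//.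
rewrite sqr_carleman_weight.
have [s1|s1] := leP (s k.+1) 1.
  by rewrite expr1n exprn_ege1// mulr_ege1// carleman_weight_ge1.
by apply: le_trans (s_cvx k) _; rewrite exprMn !sqr_carleman_weight ler_pM// le_max lexx.
Qed.

Lemma carleman_weight_dvg :
  (\sum_(1 <= m <oo) ((s m)%:E `^ ((2 * m)%:R^-1)%R)^-1 = +oo)%E ->
  forall B, exists N, B <= \sum_(0 <= k < N) M k / M k.+1.
Proof.
move=> dvg B; apply: contrapT => /forallNP nB.
have {nB}aB N : \sum_(0 <= k < N) M k / M k.+1 <= B.
  by rewrite ltW// ltNge; apply/negP/nB.
have M0 k := ltW (carleman_weight_gt0 k).
pose b k := (M 0%N / M k.+1) `^ k.+1%:R^-1.
have b0 k : 0 <= b k by exact: powR_ge0.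
have bE k : b k ^+ k.+1 = \prod_(i < k.+1) (M i / M i.+1).
  rewrite -powR_mulrn// -powRrM mulVf ?pnatr_eq0// powRr1 ?divr_ge0//.
  elim: k => [|k IHk]; first by rewrite big_ord_recl big_ord0 mulr1.
  by rewrite big_ord_recr/= -IHk mulrA divfK// gt_eqF// carleman_weight_gt0.
have bB n : series b n <= expR 1 * B.
  rewrite /series/=; apply: le_trans (@carleman_inequality R (fun i => M i / M i.+1) b n _ b0 bE) _.
    by move=> i; exact: divr_ge0.
  by apply: ler_wpM2l; [exact: expR_ge0|exact: aB].
have cvb : cvgn (series b).
  apply: nondecreasing_is_cvgn; first exact: nondecreasing_series.
  by exists (expR 1 * B) => _ [n _ <-]; exact: bB.
have b_ge k : (1 / M k.+1) `^ k.+1%:R^-1 <= b k.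
  rewrite ge0_ler_powR// ?nnegrE ?divr_ge0// ?invr_ge0//.
  by rewrite ler_wpM2r ?invr_ge0// carleman_weight_ge1.
(* Where [s k.+1 <= 1] the weight is 1 and [b k >= 1]; since [b] tends to 0, this stops
   eventually. *)
have [K _ Ks] : \forall k \near \oo, 1 < s k.+1.
  have /cvgr_lt/(_ 1 ltr01) := cvg_series_cvg_0 cvb.
  apply: filterS => k; apply: contraTT; rewrite -!leNgt => sk.
  apply: le_trans (b_ge k); rewrite /M /carleman_weight.
  by rewrite (max_idPr sk) sqrtr1 divr1 powR1.
(* By log-convexity a zero of [s] would propagate to all later indices, against [Ks]. Hence no term
   of the series takes the value 1/0. *)
have s_gt0 m : (0 < m)%N -> 0 < s m.
  move=> m0; rewrite lt0r s_ge0 andbT; apply/eqP => sm0.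
  have s0 i : s (m + i)%N = 0.
    elim: i => [|i IHi]; first by rewrite addn0.
    apply/eqP; rewrite -sqrf_eq0 eq_le sqr_ge0 andbT addnS.
    by apply: le_trans (s_cvx _) _; rewrite IHi mul0r.
  have := Ks (m + K).-1%N; rewrite /= prednK ?addn_gt0 ?m0// s0.
  by rewrite ltr10 => /(_ _)/negP[]//; lia.
pose f m := (s m `^ (2 * m)%:R^-1)^-1.
have fE m : (0 < m)%N -> (((s m)%:E `^ ((2 * m)%:R^-1)%R)^-1 = (f m)%:E)%E.
  by move=> m0; rewrite poweR_EFin inver gt_eqF// powR_gt0 ?s_gt0.
have fb k : (K <= k)%N -> f k.+1 <= b k.
  move=> Kk; apply: le_trans (b_ge k); rewrite /f natrM invfM.
  rewrite powRrM powR12_sqrt// div1r -(powR_inv1 (M0 _)) powRAC.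
  rewrite powR_inv1 ?powR_ge0// /M /carleman_weight max_l//.
  exact/ltW/Ks.
have f0 m : 0 <= f m by rewrite invr_ge0 powR_ge0.
suff : (\sum_(1 <= m <oo) ((s m)%:E `^ ((2 * m)%:R^-1)%R)^-1 < +oo)%E.
  by rewrite dvg.
(* Finitely many finite terms are set aside; the others are dominated by [b], with the index shifted
   by one. *)
rewrite (@nneseries_split _ _ 1 K); last first.
  by move=> k k0; rewrite fE// lee_fin.
apply: lte_add_pinfty.
  rewrite (eq_big_nat _ _ (F2 := fun m => (f m)%:E)); first by rewrite sumEFin ltry.
  by move=> i /andP[i1 _]; rewrite fE.
apply: le_lt_trans (ltry (expR 1 * B)); apply: lime_le.
  by apply: is_cvg_nneseries => k k1 _; rewrite fE ?lee_fin//; lia.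
apply: nearW => N.
rewrite (eq_big_nat _ _ (F2 := fun m => (f m)%:E)); last first.
  by move=> i /andP[i1 _]; rewrite fE//; lia.
rewrite sumEFin lee_fin add1n big_add1; apply: le_trans (bB N.-1).
apply: (@le_trans _ _ (\sum_(K <= k < N.-1) b k)).
  rewrite big_nat_cond [leRHS]big_nat_cond; apply: ler_sum => k.
  by rewrite andbT => /andP[Kk _]; exact: fb.
have [KN|NK] := leqP K N.-1; last first.
  by rewrite big_geq 1?ltnW// sumr_ge0.
by rewrite /series/= (big_cat_nat (leq0n K) KN)/= lerDr sumr_ge0.
Qed.

End carleman_weight.

(** * Taylor estimates for the cosine *)

Lemma is_derive_ge0_le (R : realType) (f df : R -> R) :
  (forall x, is_derive x (1 : R) f (df x)) -> (forall x, 0 <= x -> 0 <= df x) ->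
  forall b, 0 <= b -> f 0 <= f b.
Proof.
move=> fdf df0 b b0; rewrite -subr_ge0.
have [|c] := MVT_segment b0 (fun x _ => fdf x).
  apply: continuous_subspaceT => x; apply: differentiable_continuous.
  by apply/derivable1_diffP; have [] := fdf x.
by rewrite in_itv/= => /andP[c0 _] ->; rewrite subr0 mulr_ge0// df0.
Qed.

Section cos_taylor.
Variable R : realType.

(** The [k]-th derivative of the cosine: each differentiation shifts the phase by a quarter turn. *)
Definition dcos (k : nat) (x : R) : R := cos (x + k%:R * (pi / 2)).

Lemma dcosS (k : nat) (x : R) : dcos k.+1 x = - sin (x + k%:R * (pi / 2)).
Proof. by rewrite /dcos -natr1 mulrDl mul1r addrA cosDpihalf. Qed.

Lemma normr_dcos_le1 (k : nat) (x : R) : `|dcos k x| <= 1.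
Proof. by rewrite ler_norml cos_geN1 cos_le1. Qed.

Lemma dcosSS (k : nat) (x : R) : dcos k.+2 x = - dcos k x.
Proof.
rewrite /dcos.
have -> : x + k.+2%:R * (pi / 2) = (x + k%:R * (pi / 2)) + pi.
  by rewrite -addn2 natrD; field.
by rewrite cosDpi.
Qed.

Lemma dcos_odd0 (k : nat) : dcos k.*2.+1 0 = 0.
Proof.
elim: k => [|k IHk]; first by rewrite dcosS mul0r addr0 sin0 oppr0.
by rewrite doubleS dcosSS IHk oppr0.
Qed.

Global Instance is_derive_dcos (k : nat) (x : R) :
  is_derive x (1 : R) (dcos k) (dcos k.+1 x).
Proof.
rewrite dcosS.
have -> : dcos k = cos \o (shift (k%:R * (pi / 2))) by [].
rewrite -[- sin _]mulr1; apply: is_derive1_comp.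
exact: is_derive_shift.
Qed.

(** The Taylor polynomial of [dcos k] at [a] with [n] terms, as a function of the increment [b]. *)
Definition dcos_taylor (n k : nat) (a b : R) : R :=
  \sum_(i < n) dcos (k + i) a * (b ^+ i / i`!%:R).

Lemma is_derive_dcos_taylor (n k : nat) (a b : R) :
  is_derive b (1 : R) (dcos_taylor n.+1 k a) (dcos_taylor n k.+1 a b).
Proof.
elim: n => [|n IHn].
  rewrite /dcos_taylor big_ord0.
  rewrite (_ : (fun b => _) = cst (dcos (k + 0) a)); first exact: is_derive_cst.
  by apply/funext => x; rewrite big_ord1 expr0 fact0 divr1 mulr1.
rewrite /dcos_taylor.
rewrite (_ : (fun b => _) = dcos_taylor n.+1 k a +
    (dcos (k + n.+1) a / n.+1`!%:R) \*: (id ^+ n.+1)); last first.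
  apply/funext => x; rewrite big_ord_recr/= !fctE; congr (_ + _).
  rewrite /GRing.scale/= mulrCA mulrC. by [].
apply: is_derive_eq; rewrite big_ord_recr/=; congr (_ + _).
rewrite addSnnS !scaler1 /GRing.scale/= factS natrM.
have n0 : n.+1%:R != 0 :> R by rewrite pnatr_eq0.
have f0 : n`!%:R != 0 :> R by rewrite pnatr_eq0 -lt0n fact_gt0.
by field; apply/andP.
Qed.

(** Induction on [n]: the derivative in [b] of the remainder is the remainder of one order less for
    [dcos k.+1], and the bound differentiates to the previous bound. Both vanish at 0, so bound plus
    remainder and bound minus remainder are at least 0 for [b >= 0]. *)
Lemma dcos_taylor_le (n k : nat) (a b : R) : 0 <= b ->
  `|dcos k (a + b) - dcos_taylor n k a b| <= b ^+ n / n`!%:R.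
Proof.
elim: n k b => [|n IHn] k b b0.
  by rewrite /dcos_taylor big_ord0 subr0 expr0 divr1 normr_dcos_le1.
pose phi (y : R) := dcos k (a + y) - dcos_taylor n.+1 k a y.
pose psi (y : R) := y ^+ n.+1 / n.+1`!%:R.
pose dphi (y : R) := dcos k.+1 (a + y) - dcos_taylor n k.+1 a y.
pose dpsi (y : R) := y ^+ n / n`!%:R.
have d1 y : is_derive y (1 : R) phi (dphi y).
  rewrite /phi.
  have -> : (fun y => dcos k (a + y) - dcos_taylor n.+1 k a y) =
      (dcos k \o shift a) - dcos_taylor n.+1 k a.
    by apply/funext => z; rewrite !fctE/= [a + _]addrC.
  apply: is_deriveB; last exact: is_derive_dcos_taylor.
  rewrite -[dcos _ _]mulr1 addrC; apply: is_derive1_comp.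
  exact: is_derive_shift.
have d2 y : is_derive y (1 : R) psi (dpsi y).
  have -> : psi = (n.+1`!%:R^-1) \*: (id ^+ n.+1).
    by apply/funext => z; rewrite /psi !fctE mulrC.
  apply: is_derive_eq; rewrite !scaler1 /GRing.scale/= /dpsi factS natrM.
  have n0 : n.+1%:R != 0 :> R by rewrite pnatr_eq0.
  have f0 : n`!%:R != 0 :> R by rewrite pnatr_eq0 -lt0n fact_gt0.
  by field; apply/andP.
have phi0 : phi 0 = 0.
  rewrite /phi /dcos_taylor big_ord_recl/= expr0 fact0 divr1 mulr1 addn0 addr0.
  by rewrite big1 ?addr0 ?subrr// => i _; rewrite expr0n/= mul0r mulr0.
have psi0 : psi 0 = 0 by rewrite /psi expr0n/= mul0r.
have bnd y : 0 <= y -> `|dphi y| <= dpsi y by exact: IHn.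
rewrite ler_norml; apply/andP; split.
  have := @is_derive_ge0_le _ (phi + psi) _ (fun y => is_deriveD (d1 y) (d2 y)).
  move=> /(_ _ b b0); rewrite !fctE phi0 psi0 addr0 => h.
  rewrite -subr_ge0 opprK; apply: h => y y0.
  by move: (bnd y y0); rewrite ler_norml => /andP[+ _]; rewrite -subr_ge0 opprK.
have := @is_derive_ge0_le _ (psi - phi) _ (fun y => is_deriveB (d2 y) (d1 y)).
move=> /(_ _ b b0); rewrite !fctE phi0 psi0 subrr => h.
rewrite -subr_ge0; apply: h => y y0.
by move: (bnd y y0); rewrite ler_norml => /andP[_ +]; rewrite -subr_ge0.
Qed.

End cos_taylor.

(** * Cosine transforms of two measures with equal moments *)

Section two_measures.
Context d (T : measurableType d) (R : realType).
Variables (mu nu : {measure set T -> \bar R}) (D : set T).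
Hypothesis mD : measurable D.
Implicit Types f g : T -> R.

Definition integrable2 (f : T -> R) : Prop :=
  mu.-integrable D (EFin \o f) /\ nu.-integrable D (EFin \o f).

(** The integral of [f] against the signed measure [mu - nu]. *)
Definition intdiff (f : T -> R) : R :=
  \int[mu]_(x in D) f x - \int[nu]_(x in D) f x.

Lemma integrable2_measurable f : integrable2 f -> measurable_fun D f.
Proof. by case=> /measurable_int /measurable_EFinP. Qed.

Lemma integrable2_le f g : measurable_fun D f ->
  (forall x, D x -> `|f x| <= g x) -> integrable2 g -> integrable2 f.
Proof.
move=> mf fg [g1 g2]; split.
  apply: (le_integrable mD _ _ g1); first exact/measurable_EFinP.
  by move=> x Dx /=; rewrite lee_fin (le_trans (fg x Dx))// ler_norm.
apply: (le_integrable mD _ _ g2); first exact/measurable_EFinP.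
by move=> x Dx /=; rewrite lee_fin (le_trans (fg x Dx))// ler_norm.
Qed.

Lemma integrable2Z (c : R) f : integrable2 f -> integrable2 (fun x => c * f x).
Proof. by case=> f1 f2; split; [exact: (integrableZl mD c f1)|exact: (integrableZl mD c f2)]. Qed.

Lemma integrable2D f g : integrable2 f -> integrable2 g ->
  integrable2 (fun x => f x + g x).
Proof.
move=> [f1 f2] [g1 g2]; split.
  exact: (integrableD mD f1 g1).
exact: (integrableD mD f2 g2).
Qed.

Lemma eq_intdiff f g : (forall x, D x -> f x = g x) -> intdiff f = intdiff g.
Proof.
move=> fg; congr (_ - _); apply: eq_Rintegral => x /set_mem; exact: fg.
Qed.

Lemma intdiffZ c f : integrable2 f ->
  intdiff (fun x => c * f x) = c * intdiff f.
Proof. by case=> f1 f2; rewrite /intdiff !RintegralZl// mulrBr. Qed.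

Lemma intdiffD f g : integrable2 f -> integrable2 g ->
  intdiff (fun x => f x + g x) = intdiff f + intdiff g.
Proof.
move=> [f1 f2] [g1 g2]; rewrite /intdiff !RintegralD//.
by rewrite opprD addrACA.
Qed.

Lemma intdiff_sum n (F : nat -> T -> R) : (forall i, integrable2 (F i)) ->
  integrable2 (fun x => \sum_(i < n) F i x) /\
  intdiff (fun x => \sum_(i < n) F i x) = \sum_(i < n) intdiff (F i).
Proof.
move=> iF; elim: n => [|n [IH1 IH2]].
  have -> : (fun x => \sum_(i < 0) F i x) = (fun x => 0 * F 0%N x).
    by apply/funext => x; rewrite big_ord0 mul0r.
  by split; [exact: integrable2Z|rewrite intdiffZ// mul0r big_ord0].
have -> : (fun x => \sum_(i < n.+1) F i x) =
    (fun x => (\sum_(i < n) F i x) + F n x).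
  by apply/funext => x; rewrite big_ord_recr.
by split; [exact: integrable2D|rewrite intdiffD// IH2 big_ord_recr].
Qed.

Lemma normr_intdiff_le f g : measurable_fun D f ->
  (forall x, D x -> `|f x| <= g x) -> integrable2 g ->
  `|intdiff f| <= \int[mu]_(x in D) g x + \int[nu]_(x in D) g x.
Proof.
move=> mf fg ig; have [f1 f2] := integrable2_le mf fg ig; case: ig => g1 g2.
apply: le_trans (ler_normB _ _) _; apply: lerD.
  apply: le_trans (le_normr_Rintegral _ f1) _ => //.
  by apply: le_Rintegral => //; exact: integrable_norm.
apply: le_trans (le_normr_Rintegral _ f2) _ => //.
by apply: le_Rintegral => //; exact: integrable_norm.
Qed.

Variable y : T -> R.
Hypothesis my : measurable_fun D y.
Hypothesis y_ge0 : forall x, D x -> 0 <= y x.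
Hypothesis iy : forall m, integrable2 (fun x => y x ^+ m).
Hypothesis eq_y : forall m, intdiff (fun x => y x ^+ m) = 0.

Let s (m : nat) : R := \int[mu]_(x in D) (y x ^+ m).

Lemma moment_ge0 m : 0 <= s m.
Proof. by apply: Rintegral_ge0 => x Dx; rewrite exprn_ge0// y_ge0. Qed.

(** Cauchy-Schwarz, through the quadratic polynomial in [l] obtained by integrating
    [y ^+ k * (l - y) ^+ 2]. *)
Lemma moment_cvx k : s k.+1 ^+ 2 <= s k * s k.+2.
Proof.
have q (l : R) : 0 <= l ^+ 2 * s k - 2 * l * s k.+1 + s k.+2.
  have : 0 <= \int[mu]_(x in D) (l ^+ 2 * y x ^+ k +
      ((- (2 * l)) * y x ^+ k.+1 + y x ^+ k.+2)).
    apply: Rintegral_ge0 => x Dx.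
    rewrite (_ : _ + _ = y x ^+ k * (l - y x) ^+ 2); last by rewrite !exprS; ring.
    by rewrite mulr_ge0 ?sqr_ge0// exprn_ge0// y_ge0.
  have i0 := (iy k).1; have i1 := (iy k.+1).1; have i2 := (iy k.+2).1.
  rewrite RintegralD//; last 2 first.
  - exact: (integrableZl mD _ i0).
  - exact: (integrableD mD (integrableZl mD _ i1) i2).
  rewrite RintegralD//; last exact: (integrableZl mD _ i1).
  by rewrite !RintegralZl// -/(s k) -/(s k.+1) -/(s k.+2); lra.
have sk := moment_ge0 k; have sk1 := moment_ge0 k.+1.
(* If [s k = 0] the polynomial is affine in [l]; were its slope nonzero, the value of [l] chosen
   below would make it -1. *)
have [s0|s0] := eqVneq (s k) 0.
  suff -> : s k.+1 = 0 by rewrite s0 expr0n/= mul0r.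
  apply: contrapT => /eqP s1.
  have := q ((s k.+2 + 1) / (2 * s k.+1)).
  rewrite s0 mulr0 add0r.
  have -> : 2 * ((s k.+2 + 1) / (2 * s k.+1)) * s k.+1 = s k.+2 + 1 by field.
  lra.
have {}sk : 0 < s k by rewrite lt_neqAle eq_sym s0.
(* This [l] minimises the quadratic polynomial. *)
have := q (s k.+1 / s k).
have -> : (s k.+1 / s k) ^+ 2 * s k - 2 * (s k.+1 / s k) * s k.+1 + s k.+2 =
  (s k * s k.+2 - s k.+1 ^+ 2) / s k by field.
by rewrite pmulr_lge0 ?invr_gt0// subr_ge0.
Qed.

Variable G : T -> R.
Hypothesis mG : measurable_fun D G.
Hypothesis iG2 : integrable2 (fun x => G x ^+ 2).
Hypothesis eq_Gy : forall m, intdiff (fun x => G x * y x ^+ m) = 0.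

Let M := carleman_weight s.
Let t (x : T) : R := Num.sqrt (y x).

Lemma measurable_sqrt_comp : measurable_fun D t.
Proof.
by apply: measurableT_comp my; apply: continuous_measurable_fun; exact: sqrt_continuous.
Qed.

(** An integrable majorant of [|G| * t ^+ j], serving both measures; the weights are balanced so
    that its integral is of order [M j]. *)
Let dom (j : nat) (x : T) := M j / 2 * G x ^+ 2 + (M j)^-1 / 2 * y x ^+ j.

Lemma moment_nu m : \int[nu]_(x in D) (y x ^+ m) = s m.
Proof. by apply/esym/eqP; rewrite -subr_eq0; apply/eqP; exact: eq_y. Qed.

(* AM-GM: [2 |G| t^j <= M_j G^2 + t^(2j) / M_j]. *)
Lemma weight_dom j x : D x -> `|G x| * t x ^+ j <= dom j x.
Proof.
move=> Dx; have Mj : 0 < M j by exact: carleman_weight_gt0.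
rewrite /dom (_ : y x ^+ j = (t x ^+ j) ^+ 2); last first.
  by rewrite -exprM mulnC exprM sqr_sqrtr// y_ge0.
rewrite -[G x ^+ 2]real_normK ?num_real// -subr_ge0.
set a := `|G x|; set b := t x ^+ j.
rewrite (_ : _ - _ = (M j * a - b) ^+ 2 / (2 * M j)).
  by rewrite divr_ge0 ?sqr_ge0// mulr_ge0// ltW.
by field; rewrite gt_eqF.
Qed.

Lemma integrable2_dom j : integrable2 (dom j).
Proof. by apply: integrable2D; apply: integrable2Z. Qed.

Let bound := (\int[mu]_(x in D) (G x ^+ 2) + \int[nu]_(x in D) (G x ^+ 2)) / 2 + 1.

Lemma weight_bound_ge0 : 0 <= bound.
Proof.
rewrite addr_ge0// divr_ge0// addr_ge0//; apply: Rintegral_ge0 => x _;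
  exact: sqr_ge0.
Qed.

(** Since [s j <= M j ^+ 2], the term in [y ^+ j] contributes at most [M j / 2] for each measure,
    whence the 1 in [bound]. *)
Lemma int_dom_le j :
  \int[mu]_(x in D) dom j x + \int[nu]_(x in D) dom j x <= bound * M j.
Proof.
rewrite /dom.
have [g1 g2] := iG2; have [y1 y2] := iy j.
rewrite !RintegralD//; last 4 first.
- exact: (integrableZl mD _ g2).
- exact: (integrableZl mD _ y2).
- exact: (integrableZl mD _ g1).
- exact: (integrableZl mD _ y1).
rewrite !RintegralZl// moment_nu -/(s j).
have Mj : 0 < M j by exact: carleman_weight_gt0.
have : (M j)^-1 * s j <= M j.
  rewrite mulrC ler_pdivrMr// -expr2 sqr_carleman_weight.
  by rewrite le_max lexx.
rewrite /bound; set p := (M j)^-1 * _; set A := \int[mu]_(_ in _) _.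
set B := \int[nu]_(_ in _) _; move=> pM.
rewrite (_ : _ + _ = M j / 2 * A + M j / 2 * B + p); last by rewrite /p; field; rewrite gt_eqF.
by rewrite mulrDl mul1r lerD//; lra.
Qed.

(** The [j]-th derivative in [x] of [G z * cos (x * t z)]. *)
Let trig (j : nat) (x : R) (z : T) := G z * t z ^+ j * dcos j (x * t z).

Lemma measurable_dcos_root j c : measurable_fun D (fun z => dcos j (c * t z)).
Proof.
apply: measurableT_comp.
  by apply: continuous_measurable_fun => x; apply: differentiable_continuous;
  apply/derivable1_diffP; have [] := is_derive_dcos j x.
by apply: measurable_funM => //; exact: measurable_sqrt_comp.
Qed.

Lemma measurable_trig j x : measurable_fun D (trig j x).
Proof.
apply: measurable_funM; last exact: measurable_dcos_root.
by apply: measurable_funM => //; apply: measurable_funX; exact: measurable_sqrt_comp.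
Qed.

Lemma trig_le j x z : D z -> `|trig j x z| <= dom j z.
Proof.
move=> Dz; apply: le_trans (weight_dom j Dz).
rewrite /trig !normrM [`|t z ^+ j|]ger0_norm ?exprn_ge0 ?sqrtr_ge0//.
by rewrite ler_piMr ?normr_dcos_le1// mulr_ge0 ?exprn_ge0 ?sqrtr_ge0.
Qed.

Lemma integrable2_trig j x : integrable2 (trig j x).
Proof.
apply: integrable2_le (integrable2_dom j); first exact: measurable_trig.
exact: trig_le.
Qed.

Let g (j : nat) (x : R) := intdiff (trig j x).

Lemma normr_trig_int_le j x : `|g j x| <= bound * M j.
Proof.
apply: le_trans (int_dom_le j); apply: normr_intdiff_le.
- exact: measurable_trig.
- exact: trig_le.
- exact: integrable2_dom.
Qed.

(** The Taylor estimate of the cosine is applied pointwise and then integrated, which avoids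
    differentiating under the integral sign. *)
Lemma trig_int_taylor j n x h : 0 <= h ->
  `|g j (x + h)| <= \sum_(i < n) h ^+ i * `|g (j + i)%N x|
                    + h ^+ n * (bound * M (j + n)%N).
Proof.
move=> h0.
pose F i z := h ^+ i / i`!%:R * trig (j + i) x z.
have iF i : integrable2 (F i) by apply: integrable2Z; exact: integrable2_trig.
have [iS LS] := intdiff_sum n iF.
have fact_le1 i : (i`!%:R^-1 : R) <= 1.
  by rewrite invf_le1 ?ltr0n ?fact_gt0// ler1n fact_gt0.
pose Rem z := trig j (x + h) z + (-1) * \sum_(i < n) F i z.
have it := integrable2_trig j (x + h).
have LRem : intdiff Rem = g j (x + h) - \sum_(i < n) intdiff (F i).
  by rewrite /Rem intdiffD// ?intdiffZ ?LS ?mulN1r//; exact: integrable2Z.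
have RemE z : Rem z = G z * t z ^+ j *
    (dcos j (x * t z + h * t z) - dcos_taylor n j (x * t z) (h * t z)).
  rewrite /Rem mulN1r mulrBr /trig mulrDl; congr (_ - _).
  rewrite /dcos_taylor mulr_sumr; apply: eq_bigr => i _.
  by rewrite /F /trig exprMn exprD; ring.
have bRem : `|intdiff Rem| <= h ^+ n * (bound * M (j + n)%N).
  have mRem : measurable_fun D Rem.
    by apply: integrable2_measurable; apply: integrable2D => //; exact: integrable2Z.
  apply: le_trans (normr_intdiff_le (g := fun z => h ^+ n * dom (j + n)%N z) mRem _ _) _.
  - move=> z Dz; apply: le_trans (ler_wpM2l (exprn_ge0 _ h0) (weight_dom _ Dz)).
    rewrite RemE !normrM [`|t z ^+ j|]ger0_norm ?exprn_ge0 ?sqrtr_ge0//.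
    rewrite [leRHS](_ : _ = (`|G z| * t z ^+ j) * (h ^+ n * t z ^+ n)); last first.
      by rewrite exprD; ring.
    apply: ler_wpM2l; first by rewrite mulr_ge0 ?exprn_ge0 ?sqrtr_ge0.
    rewrite -exprMn.
    have ht : 0 <= h * t z by rewrite mulr_ge0// sqrtr_ge0.
    apply: le_trans (dcos_taylor_le _ _ _ ht) _.
    by rewrite ler_piMr ?exprn_ge0.
  - exact/integrable2Z/integrable2_dom.
  - have [d1 d2] := integrable2_dom (j + n).
    by rewrite !RintegralZl// -mulrDr ler_wpM2l ?exprn_ge0// int_dom_le.
have -> : g j (x + h) = \sum_(i < n) intdiff (F i) + intdiff Rem.
  by rewrite LRem [RHS]addrC subrK.
apply: le_trans (ler_normD _ _) _; apply: lerD => //.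
apply: le_trans (ler_norm_sum _ _ _) _; apply: ler_sum => i _.
rewrite /F intdiffZ; last exact: integrable2_trig.
rewrite normrM ler_wpM2r// normrM ger0_norm ?exprn_ge0// ger0_norm ?invr_ge0//.
by rewrite ler_piMr ?exprn_ge0.
Qed.

(** Odd derivatives of the cosine vanish at 0; for even [j] the factor [t ^+ j] is an integral power
    of [y], to which [eq_Gy] applies. This is why the cosine is taken of a multiple of the square
    root of [y]. *)
Lemma trig_int0 j : g j 0 = 0.
Proof.
rewrite /g -[j]odd_double_half.
pose c : R := dcos (j./2).*2 0.
case: (odd j); rewrite ?add0n ?add1n.
  rewrite (@eq_intdiff _ (fun z => 0 * G z ^+ 2)).
    by rewrite intdiffZ// mul0r.
  by move=> z _; rewrite /trig mul0r dcos_odd0 mulr0 mul0r.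
rewrite (@eq_intdiff _ (fun z => c * (G z * y z ^+ j./2))).
  rewrite intdiffZ ?eq_Gy ?mulr0//.
  apply: integrable2_le (integrable2_dom (j./2).*2).
    by apply: measurable_funM => //; exact: measurable_funX.
  move=> z Dz; apply: le_trans (weight_dom _ Dz).
  by rewrite -mul2n exprM sqr_sqrtr ?y_ge0// normrM normrX (ger0_norm (y_ge0 Dz)).
move=> z Dz; rewrite /trig mul0r -/c mulrC; congr (_ * (_ * _)).
by rewrite -mul2n exprM sqr_sqrtr// y_ge0.
Qed.

Hypothesis carleman :
  (\sum_(1 <= m <oo) ((s m)%:E `^ ((2 * m)%:R^-1)%R)^-1 = +oo)%E.

Lemma intdiff_cos_root (x : R) : intdiff (fun z => G z * cos (x * t z)) = 0.
Proof.
(* Bang's argument covers the half-line; the cosine is even. *)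
wlog x0 : x / 0 <= x.
  move=> wl; have [/wl//|/ltW x0] := leP 0 x.
  rewrite -[RHS](wl (- x)) ?oppr_ge0//; apply: eq_intdiff => z _.
  by rewrite mulNr cosN.
have := @bang_quasianalytic R M (@carleman_weight_gt0 _ s)
  (carleman_weight_cvx moment_ge0 moment_cvx) bound g weight_bound_ge0
  (fun j x _ => normr_trig_int_le j x) (fun j n x h _ h0 => trig_int_taylor j n x h0)
  (carleman_weight_dvg moment_ge0 moment_cvx carleman) trig_int0 x x0.
rewrite /g => <-; apply: eq_intdiff => z _.
by rewrite /trig /dcos expr0 mulr1 mul0r addr0.
Qed.

End two_measures.

(** * From cosines to indicators *)

(** From exp(v) >= 1 + v and (1 - v + v^2)(1 + v) = 1 + v^3 >= 1. *)
Lemma expRN_le (R : realType) (v : R) : 0 <= v -> expR (- v) <= 1 - v + v ^+ 2.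
Proof.
move=> v0; have v1 : 0 < 1 + v by rewrite ltr_pwDl.
rewrite expRN; apply: (@le_trans _ _ (1 + v)^-1).
  by rewrite lef_pV2 ?posrE ?expR_gt0// expR_ge1Dx.
rewrite -[leLHS]mul1r ler_pdivrMr// (_ : _ * _ = 1 + v ^+ 3); last by ring.
by rewrite lerDl exprn_ge0.
Qed.

(** Both functions are 1 - u^2 up to O(u^4): for the squared cosine, double the angle and use the
    Taylor estimate of order 4. *)
Lemma cos_sqr_expR (R : realType) (u : R) :
  `|cos u ^+ 2 - expR (- u ^+ 2)| <= 2 * u ^+ 4.
Proof.
wlog u0 : u / 0 <= u.
  move=> wl; have [/wl//|/ltW u0] := leP 0 u.
  by have := wl (- u); rewrite oppr_ge0 cosN sqrrN (_ : (- u) ^+ 4 = u ^+ 4); [apply|ring].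
have h2u : 0 <= 2 * u by rewrite mulr_ge0.
have := dcos_taylor_le 4 0 0 h2u.
rewrite add0r {1}/dcos mul0r addr0.
have -> : dcos_taylor 4 0 0 (2 * u) = 1 - 2 * u ^+ 2.
  rewrite /dcos_taylor !big_ord_recl big_ord0/= !add0n.
  rewrite !dcosSS dcosS /dcos !mul0r !addr0 sin0 cos0 oppr0 !mul0r oppr0.
  by rewrite /bump/= !factS fact0 /=; field.
have -> : cos (2 * u) = 2 * cos u ^+ 2 - 1.
  by rewrite mulr_natl cos_mulr2n -mulr_natl.
have -> : (2 * u) ^+ 4 / 4`!%:R = 2 / 3 * u ^+ 4.
  by rewrite !factS fact0 /=; field.
have := expR_ge1Dx (- u ^+ 2).
have := expRN_le (sqr_ge0 u); rewrite -exprM.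
rewrite !ler_norml; have : 0 <= u ^+ 4 by rewrite exprn_ge0.
lra.
Qed.

Lemma normr_subXX_le (R : realType) (a b : R) (n : nat) :
  `|a| <= 1 -> `|b| <= 1 -> `|a ^+ n - b ^+ n| <= n%:R * `|a - b|.
Proof.
move=> a1 b1; rewrite subrXX normrM mulrC ler_wpM2r//.
apply: le_trans (ler_norm_sum _ _ _) _.
rewrite -[leRHS](_ : \sum_(i < n) 1 = _); last by rewrite sumr_const card_ord.
by apply: ler_sum => i _; rewrite normrM !normrX mulr_ile1// exprn_ile1.
Qed.

(** With u = x / sqrt(n+1), the power n+1 of exp(-u^2) is the limit exactly, and passing to powers
    multiplies the error 2 u^4 by at most n+1, leaving 2 x^4 / (n+1). *)
Lemma cvg_cosX_gauss (R : realType) (x : R) :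
  cos (x / Num.sqrt n.+1%:R) ^+ (2 * n.+1) @[n --> \oo] --> expR (- x ^+ 2).
Proof.
apply/cvgrPdist_le => e e0.
have : (fun n : nat => n.+1%:R^-1 * (2 * x ^+ 4)) @ \oo --> (0 : R).
  by rewrite -[X in _ --> X](mul0r (2 * x ^+ 4)); apply: cvgMl; exact: cvg_harmonic.
move=> /cvgr0Pnorm_le/(_ e e0); apply: filterS => n.
rewrite ger0_norm; last by rewrite mulr_ge0 ?invr_ge0// mulr_ge0// (_ : x ^+ 4 = (x ^+ 2) ^+ 2) ?sqr_ge0// -exprM.
apply: le_trans; set u := x / _.
have n0 : n.+1%:R != 0 :> R by rewrite pnatr_eq0.
have u2 : u ^+ 2 = x ^+ 2 / n.+1%:R by rewrite expr_div_n sqr_sqrtr.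
have -> : expR (- x ^+ 2) = expR (- u ^+ 2) ^+ n.+1.
  by rewrite -expRM_natl u2; congr expR; field.
rewrite exprM distrC; apply: le_trans (normr_subXX_le _ _ _) _.
- by rewrite normrX exprn_ile1// ler_norml cos_geN1 cos_le1.
- by rewrite ger0_norm ?expR_ge0// -expR0 ler_expR oppr_le0 sqr_ge0.
apply: le_trans (ler_wpM2l _ (cos_sqr_expR u)) _ => //.
rewrite -[4%N]/(2 * 2)%N !exprM u2.
by rewrite le_eqVlt; apply/orP; left; apply/eqP; field.
Qed.

Lemma bernoulli_le (R : realType) (u : R) (n : nat) : 0 <= u -> u <= 1 ->
  1 - n%:R * u <= (1 - u) ^+ n.
Proof.
move=> u0 u1; elim: n => [|n IHn]; first by rewrite mul0r subr0.
rewrite exprS; apply: le_trans (ler_wpM2l _ IHn); last by rewrite subr_ge0.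
rewrite -natr1 -subr_ge0 (_ : _ - _ = n%:R * u ^+ 2); last by ring.
by rewrite mulr_ge0 ?sqr_ge0.
Qed.

(* With [k ~ n e^(n a)] the quantity [k e^(- n y)] tends to [0] for [y > a]
   and to infinity for [y <= a]. *)
Lemma cvg_laplace_step (R : realType) (a y : R) : 0 <= y ->
  (1 - expR (- (n.+1%:R * y))) ^+ (Num.truncn (n.+1%:R * expR (n.+1%:R * a)))
    @[n --> \oo] --> ((a < y)%R%:R : R).
Proof.
move=> y0.
pose u (n : nat) : R := expR (- (n.+1%:R * y)).
pose K (n : nat) : R := n.+1%:R * expR (n.+1%:R * a).
pose k (n : nat) := Num.truncn (K n).
have K0 n : 0 <= K n by rewrite mulr_ge0// expR_ge0.
have kK n : (k n)%:R <= K n by rewrite truncn_le.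
have Kk n : K n < (k n).+1%:R by exact: truncnS_gt.
have u0 n : 0 < u n by exact: expR_gt0.
have u1 n : u n <= 1 by rewrite -expR0 ler_expR oppr_le0 mulr_ge0.
have p0 n : 0 <= (1 - u n) ^+ k n by rewrite exprn_ge0// subr_ge0.
have p1 n : (1 - u n) ^+ k n <= 1.
  by rewrite exprn_ile1 ?subr_ge0// lerBlDr lerDl ltW.
have harm c : (fun n : nat => n.+1%:R^-1 * c) @ \oo --> (0 : R).
  by rewrite -[X in _ --> X](mul0r c); apply: cvgMl; exact: cvg_harmonic.
have KuE n : K n * u n = n.+1%:R * expR (n.+1%:R * (a - y)).
  by rewrite /K /u -mulrA -expRD; congr (_ * expR _); ring.
case: ltP => ay; last first.
  (* Case y <= a: here K u >= n + 1, and truncating K loses at most u <= 1, so (1 - u)^k <= exp(-k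
     u) <= exp(-n) <= 1/(n+1). *)
  apply: (@squeeze_cvgr _ _ _ _ (cst 0) (fun n => n.+1%:R^-1)).
  - apply: nearW => n; rewrite p0/=.
    apply: (@le_trans _ _ (expR (- n%:R))); last first.
      by rewrite expRN lef_pV2 ?posrE ?expR_gt0// -natr1 addrC expR_ge1Dx.
    apply: (@le_trans _ _ (expR (- u n) ^+ k n)).
      apply: lerXn2r; rewrite ?nnegrE ?subr_ge0 ?expR_ge0 ?expR_ge1Dx//; exact: u1.
    rewrite -expRM_natl ler_expR mulrN lerN2.
    have : n.+1%:R <= K n * u n.
      by rewrite KuE ler_peMr// -expR0 ler_expR mulr_ge0// subr_ge0.
    have : K n * u n <= (k n).+1%:R * u n by rewrite ler_wpM2r// ltW.
    by rewrite -!natr1 mulrDl mul1r; have := u1 n; lra.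
  - exact: cvg_cst.
  - exact: cvg_harmonic.
(* Case y > a: by Bernoulli the distance to 1 is at most K u = (n+1) exp(-(n+1) dlt), which is at
   most 2 / ((n+1) dlt^2) because exp(m) >= m^2 / 2. *)
pose dlt := y - a; have dlt0 : 0 < dlt by rewrite subr_gt0.
apply/cvgrPdist_le => e e0.
have /cvgr0Pnorm_le/(_ e e0) := harm (2 / dlt ^+ 2).
apply: filterS => n; rewrite ger0_norm ?mulr_ge0 ?divr_ge0 ?invr_ge0 ?sqr_ge0//.
apply: le_trans; rewrite ger0_norm; last by rewrite subr_ge0 p1.
apply: (@le_trans _ _ (K n * u n)).
  rewrite lerBlDr -lerBlDl; apply: le_trans (bernoulli_le _ (ltW (u0 n)) (u1 n)).
  by rewrite lerD2l lerN2; apply: ler_wpM2r; [exact: ltW (u0 n)|exact: kK].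
have m0 : 0 < n.+1%:R * dlt by rewrite mulr_gt0.
rewrite KuE (_ : n.+1%:R * (a - y) = - (n.+1%:R * dlt)); last by rewrite /dlt; ring.
rewrite expRN ler_pdivrMr ?expR_gt0//.
have := expR_ge1Dxn 1 (ltW m0); rewrite [2`!]/= => h.
have {}h : (n.+1%:R * dlt) ^+ 2 / 2 <= expR (n.+1%:R * dlt).
  by apply: le_trans h; rewrite lerDr.
apply: le_trans (ler_wpM2l _ h); last first.
  by rewrite mulr_ge0 ?divr_ge0 ?invr_ge0 ?sqr_ge0.
have n0 : n.+1%:R != 0 :> R by rewrite pnatr_eq0.
rewrite le_eqVlt; apply/orP; left; apply/eqP; field.
by rewrite gt_eqF//= nat1r.
Qed.

Section null_class.
Context d (T : measurableType d) (R : realType).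
Variables (mu nu : {measure set T -> \bar R}) (D : set T).
Hypothesis mD : measurable D.
Variable G : T -> R.
Hypothesis iG : integrable2 mu nu D G.
Implicit Types f g : T -> R.

(** Boundedness makes [G * f] integrable for both measures, so that these functions form a linear
    space. *)
Definition null_test f : Prop :=
  [/\ measurable_fun D f, exists B, forall x, D x -> `|f x| <= B &
      intdiff mu nu D (fun x => G x * f x) = 0].

Lemma integrable2_mul f B : measurable_fun D f ->
  (forall x, D x -> `|f x| <= B) -> integrable2 mu nu D (fun x => G x * f x).
Proof.
move=> mf fB; apply: (@integrable2_le _ _ _ mu nu _ mD _ (fun x => B * `|G x|)).
- by apply: measurable_funM => //; exact: integrable2_measurable iG.
- by move=> x Dx; rewrite normrM mulrC ler_wpM2r// fB.
- by apply: integrable2Z => //; case: iG => g1 g2; split; exact: integrable_norm.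
Qed.

Lemma null_test_lin a b f g : null_test f -> null_test g ->
  null_test (fun x => a * f x + b * g x).
Proof.
move=> [mf [B fB] f0] [mg [C gC] g0]; split.
- by apply: measurable_funD; apply: measurable_funM.
- exists (`|a| * B + `|b| * C) => x Dx.
  by apply: le_trans (ler_normD _ _) _; rewrite !normrM lerD// ler_wpM2l ?fB ?gC.
rewrite (@eq_intdiff _ _ _ _ _ _ _
  (fun x => a * (G x * f x) + b * (G x * g x))); last by move=> x _; ring.
have i1 := integrable2_mul mf fB; have i2 := integrable2_mul mg gC.
by rewrite intdiffD ?intdiffZ ?f0 ?g0 ?mulr0 ?addr0//; exact: integrable2Z.
Qed.

Lemma eq_null_test f g : (forall x, D x -> f x = g x) ->
  null_test f -> null_test g.
Proof.
move=> fg [mf [B fB] f0]; split.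
- by apply: eq_measurable_fun mf => x /set_mem; exact: fg.
- by exists B => x Dx; rewrite -fg// fB.
- by rewrite -f0; apply: eq_intdiff => x Dx; rewrite fg.
Qed.

(** Dominated convergence for each measure, with majorant [|G|]. *)
Lemma null_test_cvg (f : nat -> T -> R) g : (forall n, null_test (f n)) ->
  (forall n x, D x -> `|f n x| <= 1) ->
  (forall x, D x -> f n x @[n --> \oo] --> g x) -> null_test g.
Proof.
move=> f0 f1 fg.
have mf n : measurable_fun D (f n) by have [] := f0 n.
have mg : measurable_fun D g by exact: measurable_fun_cvg fg.
have g1 x : D x -> `|g x| <= 1.
  move=> Dx; have /cvg_norm := fg x Dx.
  by move=> /(@cvgr_to_le _ _ _ _ _ _ 1); apply; apply: nearW => n; exact: f1.
split=> //; first by exists 1.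
have main (m : {measure set T -> \bar R}) : m.-integrable D (EFin \o G) ->
    \int[m]_(x in D) (G x * f n x) @[n --> \oo] --> \int[m]_(x in D) (G x * g x).
  move=> imG.
  have mG : measurable_fun D G by exact/measurable_EFinP/(measurable_int m).
  have imf (h : T -> R) : measurable_fun D h -> (forall x, D x -> `|h x| <= 1) ->
      m.-integrable D (EFin \o (fun x => G x * h x)).
    move=> mh h1; apply: (le_integrable mD _ _ imG).
      by apply/measurable_EFinP; exact: measurable_funM.
    by move=> x Dx /=; rewrite lee_fin normrM ler_piMr// h1.
  apply: fine_cvg; rewrite fineK; last exact: integrable_fin_num (imf _ mg g1).
  have mGh (h : T -> R) : measurable_fun D h ->
      measurable_fun D (fun x => (G x * h x)%:E).
    by move=> mh; apply/measurable_EFinP; exact: measurable_funM.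
  apply: (@dominated_cvg _ _ _ m D mD (fun n x => (G x * f n x)%:E)
    (fun x => (G x * g x)%:E) (fun x => `|G x|%:E)).
  - by move=> n; exact: mGh.
  - move=> x Dx; apply: cvg_EFin; first exact: nearW.
    by apply: cvgMr; exact: fg.
  - by [].
  - exact: integrable_norm.
  - by move=> n x Dx; rewrite lee_fin normrM ler_piMr// f1.
have [i1 i2] := iG.
have L1 : (fun n => \int[mu]_(x in D) (G x * f n x)) -
    (fun n => \int[nu]_(x in D) (G x * f n x)) @ \oo -->
    \int[mu]_(x in D) (G x * g x) - \int[nu]_(x in D) (G x * g x).
  by apply: cvgB; [exact: main|exact: main].
have L0 : (fun n => \int[mu]_(x in D) (G x * f n x)) -
    (fun n => \int[nu]_(x in D) (G x * f n x)) @ \oo --> (0 : R).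
  rewrite (_ : _ - _ = cst (0 : R)); first exact: cvg_cst.
  by apply/funext => n; rewrite !fctE; have [_ _] := f0 n.
have L := cvg_lim (@Rhausdorff R) L1.
rewrite (cvg_lim (@Rhausdorff R) L0) in L.
exact: esym (L _).
Qed.

End null_class.

Section determinacy_step.
Context d (T : measurableType d) (R : realType).
Variables (mu nu : {measure set T -> \bar R}) (D : set T).
Hypothesis mD : measurable D.
Variable y : T -> R.
Hypothesis my : measurable_fun D y.
Hypothesis y_ge0 : forall x, D x -> 0 <= y x.
Hypothesis iy : forall m, integrable2 mu nu D (fun x => y x ^+ m).
Hypothesis eq_y : forall m, intdiff mu nu D (fun x => y x ^+ m) = 0.
Hypothesis carleman :
  (\sum_(1 <= m <oo)
     ((\int[mu]_(x in D) (y x ^+ m))%:E `^ ((2 * m)%:R^-1)%R)^-1 = +oo)%E.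
Variable G : T -> R.
Hypothesis mG : measurable_fun D G.
Hypothesis iG2 : integrable2 mu nu D (fun x => G x ^+ 2).
Hypothesis eq_Gy : forall m, intdiff mu nu D (fun x => G x * y x ^+ m) = 0.

(** [|G| <= G ^+ 2 + 1], and the constant 1 is the moment of order 0. *)
Lemma integrable2_of_sqr : integrable2 mu nu D G.
Proof.
apply: integrable2_le (integrable2D mD iG2 (iy 0)) => // x _.
rewrite expr0 -real_normK ?num_real//.
by have := sqr_ge0 (`|G x| - 2^-1); rewrite sqrrB; lra.
Qed.

Let iG := integrable2_of_sqr.
Let null := null_test mu nu D G.

Lemma null_test_cos c : null (fun z => cos (c * Num.sqrt (y z))).
Proof.
split.
- apply: measurableT_comp.
    by apply: continuous_measurable_fun; exact: continuous_cos.
  by apply: measurable_funM => //; exact: measurable_sqrt_comp.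
- by exists 1 => x _; rewrite ler_norml cos_geN1 cos_le1.
- exact: (intdiff_cos_root mD my y_ge0 iy eq_y mG iG2 eq_Gy carleman).
Qed.

(** The product formula for cosines lowers [k] at the price of changing the frequency [e]; this
    extra factor makes the induction close and disappears at [e = 0]. *)
Lemma null_test_cosX c k e :
  null (fun z => cos (c * Num.sqrt (y z)) ^+ k * cos (e * Num.sqrt (y z))).
Proof.
elim: k e => [|k IHk] e.
  by apply: eq_null_test (null_test_cos e) => x _; rewrite expr0 mul1r.
apply: eq_null_test (null_test_lin mD iG 2^-1 2^-1 (IHk (c + e)) (IHk (c - e))).
by move=> x _ /=; rewrite mulrDl mulrBl cosD cosB exprS; field.
Qed.

Lemma null_test_laplace c : 0 <= c -> null (fun z => expR (- (c * y z))).
Proof.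
move=> c0; apply: (null_test_cvg mD iG (f := fun n z =>
  cos (Num.sqrt c * Num.sqrt (y z) / Num.sqrt n.+1%:R) ^+ (2 * n.+1))).
- move=> n; apply: eq_null_test
    (null_test_cosX (Num.sqrt c / Num.sqrt n.+1%:R) (2 * n.+1) 0) => x _.
  by rewrite mul0r cos0 mulr1 mulrAC.
- by move=> n x _; rewrite normrX exprn_ile1// ler_norml cos_geN1 cos_le1.
- move=> x Dx; have -> : c * y x = (Num.sqrt c * Num.sqrt (y x)) ^+ 2.
    by rewrite exprMn !sqr_sqrtr// y_ge0.
  exact: cvg_cosX_gauss.
Qed.

(** Expanding one factor [1 - expR (- (c * y z))] replaces [e] by [e] and [c + e], hence the
    induction with [e] free. *)
Lemma null_test_laplaceX c k e : 0 <= c -> 0 <= e ->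
  null (fun z => (1 - expR (- (c * y z))) ^+ k * expR (- (e * y z))).
Proof.
move=> c0; elim: k e => [|k IHk] e e0.
  by apply: eq_null_test (null_test_laplace e0) => x _; rewrite expr0 mul1r.
apply: eq_null_test
  (null_test_lin mD iG 1 (-1) (IHk e e0) (IHk (c + e) (addr_ge0 c0 e0))).
by move=> x _ /=; rewrite mulrDl opprD expRD exprS; ring.
Qed.

Lemma null_test_indic a : null (fun z => (a < y z)%R%:R).
Proof.
apply: (null_test_cvg mD iG (f := fun n z => (1 - expR (- (n.+1%:R * y z)))
  ^+ (Num.truncn (n.+1%:R * expR (n.+1%:R * a))))).
- move=> n; apply: eq_null_test (null_test_laplaceX
    (Num.truncn (n.+1%:R * expR (n.+1%:R * a))) (ler0n R n.+1) (lexx 0)) => x _.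
  by rewrite mul0r oppr0 expR0 mulr1.
- move=> n x Dx; have e1 : expR (- (n.+1%:R * y x)) <= 1.
    by rewrite -expR0 ler_expR oppr_le0 mulr_ge0// y_ge0.
  by rewrite ger0_norm ?exprn_ge0 ?exprn_ile1 ?subr_ge0// lerBlDr lerDl expR_ge0.
- by move=> x Dx; exact/cvg_laplace_step/y_ge0.
Qed.

End determinacy_step.

(** * From monomials to indicators of boxes, one coordinate at a time *)

Section determinacy_boxes.
Context d (T : measurableType d) (R : realType) (n : nat).
Variables (mu nu : {measure set T -> \bar R}) (D : set T).
Hypothesis mD : measurable D.
Variable y : 'I_n -> T -> R.
Hypothesis my : forall j, measurable_fun D (y j).
Hypothesis y_ge0 : forall j x, D x -> 0 <= y j x.
Let monomial (a : 'I_n -> nat) (x : T) := \prod_(j < n) y j x ^+ a j.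
Hypothesis iy : forall a, integrable2 mu nu D (monomial a).
Hypothesis eq_y : forall a, intdiff mu nu D (monomial a) = 0.
Hypothesis carleman : forall j,
  (\sum_(1 <= m <oo)
     ((\int[mu]_(x in D) (y j x ^+ m))%:E `^ ((2 * m)%:R^-1)%R)^-1 = +oo)%E.

Lemma monomial1 j m x : monomial (fun i => if i == j then m else 0%N) x = y j x ^+ m.
Proof.
rewrite /monomial (bigD1 j)//= eqxx big1 ?mulr1// => i /negPf ->.
by rewrite expr0.
Qed.

(** Interpolates between the monomial of exponents [a], at [k = 0], and the indicator of a box, at
    [k = n]. *)
Let mixed (c : 'I_n -> R) (k : nat) (a : 'I_n -> nat) (x : T) :=
  \prod_(j < n) if (j < k)%N then (c j < y j x)%R%:R else y j x ^+ a j.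

Lemma intdiff_mixed c k a : (k <= n)%N -> intdiff mu nu D (mixed c k a) = 0.
Proof.
elim: k a => [|k IHk] a; first by move=> _; exact: eq_y.
move=> kn; pose i := Ordinal kn.
pose G x := \prod_(j < n | j != i)
  if (j < k)%N then (c j < y j x)%R%:R else y j x ^+ a j.
(* [G] omits the factor [i], so varying the exponent there in the induction hypothesis yields all
   the moments of [y i] against [G]. *)
pose am m := fun j => if j == i then m else a j.
have mixedE m x : mixed c k (am m) x = G x * y i x ^+ m.
  rewrite /mixed (bigD1 i)//= ltnn /am eqxx mulrC; congr (_ * _).
  by apply: eq_bigr => j /negPf ->.
have mixedSE x : mixed c k.+1 a x = G x * (c i < y i x)%R%:R.
  rewrite /mixed (bigD1 i)//= ltnSn mulrC; congr (_ * _).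
  apply: eq_bigr => j ji; rewrite ltnS leq_eqVlt.
  by rewrite (_ : (j == k :> nat) = false)//; apply: contra_neqF ji => /eqP jk; exact: val_inj.
have mG : measurable_fun D G.
  rewrite /G; under eq_fun do rewrite big_mkcond.
  apply: measurable_prod => j _; case: (j != i) => //; case: (j < k)%N.
    rewrite (_ : (fun x => _) = fun x => if c j < y j x then 1 else 0).
      by apply: measurable_fun_if => //; exact: measurable_fun_ltr.
    by apply/funext => x; case: ifP.
  exact: measurable_funX.
have iG2 : integrable2 mu nu D (fun x => G x ^+ 2).
  (* Indicators are at most 1, so [G ^+ 2] is dominated by the monomial that doubles the exponents
     of the untreated coordinates. *)
  pose b (j : 'I_n) := if (j == i) || (j < k)%N then 0%N else (2 * a j)%N.
  apply: integrable2_le (iy b) => //; first exact: measurable_funX.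
  move=> x Dx; rewrite normrX /G normr_prod -prodrXl /monomial.
  rewrite [leRHS](bigD1 i)//= {1}/b eqxx expr0 mul1r.
  apply: ler_prod => j ji; rewrite exprn_ge0//= /b (negPf ji)/=.
  case: ifP => _; last by rewrite normrX (ger0_norm (y_ge0 j Dx)) -exprM mulnC.
  by rewrite expr0; case: (_ < _)%R; rewrite ?normr1 ?normr0 ?expr1n ?expr0n/=.
have i1 m : integrable2 mu nu D (fun x => y i x ^+ m).
  have := iy (fun j => if j == i then m else 0%N).
  by congr (integrable2 _ _ _ _); apply/funext => x; rewrite monomial1.
have e1 m : intdiff mu nu D (fun x => y i x ^+ m) = 0.
  have := eq_y (fun j => if j == i then m else 0%N).
  by congr (intdiff _ _ _ _ = 0); apply/funext => x; rewrite monomial1.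
have eG m : intdiff mu nu D (fun x => G x * y i x ^+ m) = 0.
  rewrite -(IHk (am m) (ltnW kn)).
  by congr (intdiff _ _ _ _); apply/funext => x; rewrite mixedE.
have [_ _] := null_test_indic mD (my i) (y_ge0 i) i1 e1 (carleman i) mG iG2 eG (c i).
by move=> <-; congr (intdiff _ _ _ _); apply/funext => x; rewrite mixedSE.
Qed.

End determinacy_boxes.

(** * The cone and the Borel sets in dual coordinates *)

Section dot_product.
Variables (R : realType) (n : nat).
Implicit Types w x : 'rV[R]_n.

Lemma dotv_sumr w (c : 'I_n -> R) (v : n.-tuple 'rV[R]_n) :
  dotv w (\sum_(i < n) c i *: tnth v i) = \sum_(i < n) c i * dotv w (tnth v i).
Proof.
rewrite /dotv; under eq_bigr do rewrite summxE mulr_sumr.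
rewrite exchange_big/=; apply: eq_bigr => i _; rewrite mulr_sumr.
by apply: eq_bigr => k _; rewrite mxE mulrCA.
Qed.

Lemma dual_expansion (v v' : n.-tuple 'rV[R]_n) :
  basis_of fullv v ->
  (forall i j : 'I_n, dotv (tnth v' i) (tnth v j) = (i == j)%:R) ->
  forall x, x = \sum_(i < n) dotv (tnth v' i) x *: tnth v i.
Proof.
move=> bv vv' x.
have xE : x = \sum_(i < n) coord v i x *: tnth v i.
  rewrite {1}(coord_basis bv (memvf x)).
  by apply: eq_bigr => i _; rewrite (tnth_nth 0).
rewrite {1}xE; apply: eq_bigr => i _; congr (_ *: _).
rewrite [in RHS]xE dotv_sumr (bigD1 i)//= vv' eqxx mulr1 big1 ?addr0// => j ji.
by rewrite vv' eq_sym (negbTE ji) mulr0.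
Qed.

Lemma normr_le_enorm x i : `|x 0 i| <= enorm x.
Proof.
rewrite -sqrtr_sqr /enorm ler_wsqrtr// /dotv (bigD1 i)//= -expr2 lerDl.
by apply: sumr_ge0 => j _; rewrite -expr2 sqr_ge0.
Qed.

Lemma normr_dotv_le w x : `|dotv w x| <= (\sum_(i < n) `|w 0 i|) * enorm x.
Proof.
apply: le_trans (ler_norm_sum _ _ _) _; rewrite mulr_suml.
by apply: ler_sum => i _; rewrite normrM ler_wpM2l// normr_le_enorm.
Qed.

End dot_product.

Lemma positive_coneE (R : realType) (n : nat) (v v' : n.-tuple 'rV[R]_n) :
  basis_of fullv v ->
  (forall i j : 'I_n, dotv (tnth v' i) (tnth v j) = (i == j)%:R) ->
  positive_cone v = [set x | forall j, 0 <= dotv (tnth v' j) x].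
Proof.
move=> bv vv'; apply/seteqP; split=> x /=.
  move=> [c [c0 ->]] j; rewrite dotv_sumr (bigD1 j)//= vv' eqxx mulr1.
  by rewrite big1 ?addr0// => i ij; rewrite vv' eq_sym (negbTE ij) mulr0.
by move=> x0; exists (fun j => dotv (tnth v' j) x); split=> //; exact: dual_expansion.
Qed.

Section borel_rV.
Variables (R : realType) (n : nat).

Lemma measurable_coord i : measurable_fun [set: borel_rV R n]
  (fun x : borel_rV R n => (x : 'rV[R]_n) 0 i : R).
Proof.
apply: (measurability _ (RGenOpens.measurableE R)).
move=> _ [_ [a [b ->] <-]]; rewrite setTI; apply: sub_sigma_algebra.
have /continuousP := @coord_continuous R 1 n 0 i.
by apply; exact: interval_open.
Qed.

Lemma measurable_dotv (w : 'rV[R]_n) : measurable_fun [set: borel_rV R n]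
  (fun x : borel_rV R n => dotv w x : R).
Proof.
by apply: measurable_sum => i; apply: measurable_funM => //; exact: measurable_coord.
Qed.

(* [U] is a countable union of rational cubes. *)
Lemma open_measurable_of_coord d (T : measurableType d) (f : T -> 'rV[R]_n)
    (U : set 'rV[R]_n) :
  (forall i, measurable_fun [set: T] (fun t => f t 0 i)) -> open U ->
  measurable (f @^-1` U).
Proof.
move=> mf oU.
pose cube (p : 'rV[rat]_n * nat) : set 'rV[R]_n :=
  [set x | forall i, `|x 0 i - ratr (p.1 0 i)| < p.2.+1%:R^-1].
have mcube p : measurable (f @^-1` cube p).
  rewrite (_ : _ @^-1` _ = \bigcap_(i in [set: 'I_n])
    ((fun t => `|f t 0 i - ratr (p.1 0 i)|) @^-1` `]-oo, p.2.+1%:R^-1[)).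
    apply: fin_bigcap_measurable => // i _; rewrite -[X in measurable X]setTI.
    have : measurable_fun [set: T] (fun t => `|f t 0 i - ratr (p.1 0 i)|).
      by apply: measurableT_comp => //; exact: measurable_funB.
    by apply.
  by apply/seteqP; split=> t /= h i; have := h i; rewrite ?in_itv//=; apply.
pose I := [set p | cube p `<=` U].
have -> : f @^-1` U = \bigcup_p (if p \in I then f @^-1` cube p else set0).
  apply/seteqP; split=> t /=; last first.
    by move=> [p _]; case: ifPn => // /set_mem pU /pU.
  move=> Uft; have /nbhs_ballP[e /= e0 eU] : nbhs (f t) U by exact: open_nbhs_nbhs.
  (* With a radius below [e / 2], a cube containing [f t] lies in the sup-norm ball of radius [e]
     around it. *)
  have [k] := ltr_add_invr (divr_gt0 e0 (ltr0Sn R 1)).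
  rewrite add0r => ke.
  have k0 : 0 < k.+1%:R^-1 :> R by rewrite invr_gt0.
  have qP i : exists q : rat, `|f t 0 i - ratr q| < k.+1%:R^-1.
    have := @rat_in_itvoo R (f t 0 i - k.+1%:R^-1) (f t 0 i + k.+1%:R^-1).
    rewrite ltrBlDr -addrA ltrDl addr_gt0// => /(_ isT)[q].
    rewrite in_itv/= => /andP[q1 q2]; exists q.
    by rewrite distrC ltr_distl q1 q2.
  have [q qE] := choice qP.
  exists (\row_i q i, k) => //.
  have cubeft : cube (\row_i q i, k) (f t) by move=> i /=; rewrite mxE.
  rewrite ifT// inE => x cx; apply: eU; split=> // i j.
  rewrite ord1 /ball/=; have := cx j; rewrite mxE => xq.
  have fq := qE j.
  have -> : f t 0 j - x 0 j = (f t 0 j - ratr (q j)) - (x 0 j - ratr (q j)) by ring.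
  apply: le_lt_trans (ler_normB _ _) _; rewrite [ltRHS]splitr.
  exact: ltrD (lt_trans fq ke) (lt_trans xq ke).
apply: countable_bigcupT_measurable; first exact: countableP.
by move=> p; case: ifP.
Qed.

End borel_rV.

Section dual_coordinates.
Variables (R : realType) (n : nat) (v v' : n.-tuple 'rV[R]_n).
Hypothesis hv : basis_of fullv v.
Hypothesis hv' : forall i j : 'I_n, dotv (tnth v' i) (tnth v j) = (i == j)%:R.

Let y (j : 'I_n) (x : borel_rV R n) : R := dotv (tnth v' j) x.
Let C : set (borel_rV R n) := positive_cone v.

Lemma measurable_positive_cone : measurable C.
Proof.
rewrite /C (positive_coneE hv hv').
rewrite (_ : [set x | _] = \bigcap_(j in [set: 'I_n]) (y j @^-1` `[0, +oo[)).
  apply: fin_bigcap_measurable => // j _; rewrite -[X in measurable X]setTI.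
  have : measurable_fun [set: borel_rV R n] (y j) by exact: measurable_dotv.
  by apply.
apply/seteqP; split=> x h j /=; first by have hj := h j; rewrite in_itv/= andbT.
by have := h j Logic.I; rewrite /= in_itv/= andbT.
Qed.

Definition dual_box (c : 'I_n -> R) : set (borel_rV R n) :=
  [set x | forall j, c j < y j x].

Definition dual_boxes : set (set (borel_rV R n)) := range dual_box.

Lemma measurable_dual_box c : measurable (dual_box c).
Proof.
rewrite (_ : dual_box c = \bigcap_(j in [set: 'I_n]) (y j @^-1` `]c j, +oo[)).
  apply: fin_bigcap_measurable => // j _; rewrite -[X in measurable X]setTI.
  have : measurable_fun [set: borel_rV R n] (y j) by exact: measurable_dotv.
  by apply.
apply/seteqP; split=> x h j /=; first by have hj := h j; rewrite in_itv/= andbT.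
by have := h j Logic.I; rewrite /= in_itv/= andbT.
Qed.

Lemma dual_boxes_setI : setI_closed dual_boxes.
Proof.
move=> _ _ [c _ <-] [c' _ <-]; exists (fun j => Num.max (c j) (c' j)) => //.
apply/seteqP; split=> x /=.
  by move=> h; split=> j; have := h j; rewrite gt_max => /andP[].
by move=> [h1 h2] j; rewrite gt_max h1 h2.
Qed.

Lemma exists_natr_lt (z : 'I_n -> R) : exists k : nat, forall j, - k%:R < z j.
Proof.
exists (Num.bound (\sum_(j < n) `|z j|)) => j.
rewrite ltrNl; apply: le_lt_trans (archi_boundP _); last exact: sumr_ge0.
rewrite (bigD1 j)//=; apply: le_trans (ler_norm _) _.
by rewrite normrN lerDl sumr_ge0.
Qed.

Lemma dual_boxes_cover : \bigcup_k dual_box (fun=> - k%:R) = setT.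
Proof.
rewrite -subTset => x _; have [k kx] := exists_natr_lt (y ^~ x).
by exists k.
Qed.

(** A half-space [a < y j] is the union over [k] of boxes whose other bounds are [- k], so each
    [y j] is measurable for the generated sigma-algebra. The standard coordinates are linear
    combinations of the [y j], and open sets are measurable as soon as the coordinates are. *)
Lemma dual_boxes_generate (A : set (borel_rV R n)) :
  measurable A -> <<s dual_boxes >> A.
Proof.
pose GT := g_sigma_algebraType dual_boxes.
have my j : measurable_fun [set: GT] (y j : GT -> R).
  apply: (measurability _ (RGenOInfty.measurableE R)).
  move=> _ [_ [a ->] <-]; rewrite setTI.
  rewrite (_ : _ @^-1` _ =
    \bigcup_k dual_box (fun i => if i == j then a else - k%:R)).
    by apply: bigcupT_measurable => k; apply: sub_sigma_algebra; eexists.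
  apply/seteqP; split=> x /=; rewrite in_itv/= andbT.
    move=> ax; have [k kx] := exists_natr_lt (y ^~ x).
    by exists k => // i; case: eqP => [->|_].
  by move=> [k _ /(_ j)]; rewrite eqxx.
apply: smallest_sub; first exact: smallest_sigma_algebra.
move=> U oU; apply: (@open_measurable_of_coord R n _ GT id) => // i.
rewrite (_ : (fun t => _) = fun t : GT => \sum_(j < n) y j t * tnth v j 0 i).
  by apply: measurable_sum => j; apply: measurable_funM.
apply/funext => t; rewrite [in LHS](dual_expansion hv hv' t) summxE.
by apply: eq_bigr => j _; rewrite mxE.
Qed.

Definition dual_monomial (a : 'I_n -> nat) (x : borel_rV R n) : R := \prod_(j < n) y j x ^+ a j.

Lemma mpoly_fun_dual_monomial (a : 'I_n -> nat) :
  exists P : mpoly.mpoly n R, forall x, mpoly_fun P x = dual_monomial a x.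
Proof.
exists (\prod_(j < n) (\sum_(i < n)
  tnth v' j 0 i *: mpoly.mpolyX R (mpoly.mnm1 i)) ^+ a j) => x.
rewrite /mpoly_fun rmorph_prod; apply: eq_bigr => j _.
rewrite rmorphXn rmorph_sum; congr (_ ^+ _); apply: eq_bigr => i _.
apply: etrans (mpoly.mevalZ _ _ _) _; congr (_ * _).
exact: mpoly.mevalXU.
Qed.

Lemma measurable_enorm : measurable_fun [set: borel_rV R n]
  (fun x : borel_rV R n => enorm x).
Proof.
have mdot : measurable_fun [set: borel_rV R n] (fun x : borel_rV R n => dotv x x).
  by apply: measurable_sum => i; apply: measurable_funM; exact: measurable_coord.
by apply: measurableT_comp mdot; apply: continuous_measurable_fun; exact: sqrt_continuous.
Qed.

Lemma integrable_enormX (mu : {measure set (borel_rV R n) -> \bar R}) (d : nat) :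
  finite_moments mu -> mu.-integrable setT (fun x => (enorm x ^+ d)%:E).
Proof.
move=> fmu; apply/integrableP; split.
  by apply/measurable_EFinP; apply: measurable_funX; exact: measurable_enorm.
have := fmu d%:R (ler0n _ _); apply: le_lt_trans.
rewrite le_eqVlt; apply/orP; left; apply/eqP; apply: eq_integral => x _.
by rewrite powR_mulrn ?sqrtr_ge0//= ger0_norm// exprn_ge0// sqrtr_ge0.
Qed.

(** Each [y j] is at most a constant times [enorm], so the monomial is dominated by a multiple of a
    power of [enorm]. *)
Lemma integrable_dual_monomial (mu : {measure set (borel_rV R n) -> \bar R}) a :
  finite_moments mu -> mu.-integrable C (EFin \o dual_monomial a).
Proof.
move=> fmu; apply: (integrableS measurableT measurable_positive_cone) => //.
pose W j := \sum_(i < n) `|tnth v' j 0 i|.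
pose K := \prod_(j < n) W j ^+ a j.
have iK := integrableZl measurableT K (integrable_enormX (\sum_(j < n) a j)%N fmu).
apply: le_integrable iK => //.
  apply/measurable_EFinP; apply: measurable_prod => j _.
  by apply: measurable_funX; exact: measurable_dotv.
move=> x _; rewrite /= lee_fin; apply: le_trans (ler_norm _).
rewrite /dual_monomial normr_prod /K expr_sum -big_split/=.
apply: ler_prod => j _; rewrite normr_ge0 normrX -exprMn/=.
by rewrite lerXn2r ?nnegrE ?normr_dotv_le// mulr_ge0 ?sqrtr_ge0// sumr_ge0.
Qed.

Lemma measure_supported (mu : {measure set (borel_rV R n) -> \bar R}) A :
  supported_in mu C -> measurable A -> mu A = mu (A `&` C).
Proof.
move=> sC mA; have mC := measurable_positive_cone.
have AC0 : mu (A `\` C) = 0%E; last first.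
  apply: etrans (measureDI mu mA mC) _; rewrite -[RHS]add0e.
  by congr (_ + _)%E.
apply/negligibleP; first exact: measurableD.
by apply: negligibleS sC => x [].
Qed.

End dual_coordinates.

(** * Equality of the two measures on boxes, then on Borel sets *)

Theorem theorem5p1 (R : realType) (n : nat) (v v' : n.-tuple 'rV[R]_n)
    (hv : basis_of fullv v)
    (hv' : forall i j : 'I_n, dotv (tnth v' i) (tnth v j) = (i == j)%:R)
    (mu : {measure set (borel_rV R n) -> \bar R})
    (hmu : finite_moments mu)
    (hsupp : supported_in mu (positive_cone v))
    (hcarl : forall j : 'I_n,
      (\sum_(1 <= m <oo)
         (dual_moment (positive_cone v) mu (tnth v' j) m
            `^ ((2 * m)%:R^-1)%R)^-1 = +oo)%E) :
  determinate_on (positive_cone v) mu.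
Proof.
move=> nu hnu hsuppn eq_int A mA.
pose C : set (borel_rV R n) := positive_cone v.
pose y (j : 'I_n) (x : borel_rV R n) : R := dotv (tnth v' j) x.
have mC : measurable C := measurable_positive_cone hv hv'.
have my j : measurable_fun C (y j) by apply: measurable_funTS; exact: measurable_dotv.
have y_ge0 j x : C x -> 0 <= y j x by rewrite /C (positive_coneE hv hv'); apply.
have iy a : integrable2 mu nu C (dual_monomial v' a).
  by split; exact: (integrable_dual_monomial hv hv').
have eq_y a : intdiff mu nu C (dual_monomial v' a) = 0.
  have [P PE] := mpoly_fun_dual_monomial v' a.
  apply/eqP; rewrite subr_eq0; apply/eqP; congr fine.
  have PI (m : {measure set (borel_rV R n) -> \bar R}) :
      (\int[m]_(x in C) (mpoly_fun P x)%:E =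
       \int[m]_(x in C) (dual_monomial v' a x)%:E)%E.
    by apply: eq_integral => x _; rewrite PE.
  by rewrite -!PI eq_int.
(* The moments are finite, so the extended real [dual_moment] may be replaced by a real integral. *)
have carl j : (\sum_(1 <= m <oo)
    ((\int[mu]_(x in C) (y j x ^+ m))%:E `^ ((2 * m)%:R^-1)%R)^-1 = +oo)%E.
  rewrite -(hcarl j); apply: eq_eseriesr => m _; congr ((_ `^ _)^-1)%E.
  rewrite fineK//; apply: integrable_fin_num => //.
  have [+ _] := iy (fun i => if i == j then m else 0%N).
  by congr (_.-integrable _ _); apply/funext => x /=; rewrite -monomial1.
(* Finiteness is recorded too, since uniqueness of measures asks for a cover by sets of finite
   measure. Both measures may be restricted to the cone, where the indicator of the box is [mixed]
   at [k = n]. *)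
have boxE c : mu (dual_box v' c) = nu (dual_box v' c) /\ (mu (dual_box v' c) < +oo)%E.
  have mB := measurable_dual_box v' c.
  rewrite (measure_supported hv hv' hsupp mB) (measure_supported hv hv' hsuppn mB).
  have indE x : \prod_(j < n) (if (j < n)%N then (c j < y j x)%R%:R else y j x ^+ 0)
      = \1_(dual_box v' c) x :> R.
    rewrite indicE; have [xB|xB] := pselect (dual_box v' c x).
      by rewrite mem_set// big1// => j _; rewrite ltn_ord (xB j).
    rewrite memNset//; have [j /negP/negbTE xj] := (existsNP _).2 xB.
    by rewrite (bigD1 j)//= ltn_ord xj mul0r.
  (* The dominating function is the monomial with zero exponents, the constant 1. *)
  have [i1 i2] : integrable2 mu nu C (\1_(dual_box v' c) : _ -> R).
    apply: (integrable2_le mC _ _ (iy (fun=> 0%N))).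
      by apply: measurable_funTS; exact: measurable_indic.
    move=> x _; rewrite /dual_monomial big1// ger0_norm ?indicE//.
    by case: (_ \in _).
  have muE := integral_indic mu mC mB; have nuE := integral_indic nu mC mB.
  have mufin : mu (dual_box v' c `&` C) \is a fin_num.
    by rewrite -muE; exact: integrable_fin_num.
  have nufin : nu (dual_box v' c `&` C) \is a fin_num.
    by rewrite -nuE; exact: integrable_fin_num.
  split; last by rewrite -ge0_fin_numE.
  rewrite -(fineK mufin) -(fineK nufin); congr (_%:E).
  rewrite -muE -nuE; apply/eqP; rewrite -subr_eq0; apply/eqP.
  rewrite -[RHS](intdiff_mixed mC my y_ge0 iy eq_y carl c (fun=> 0%N) (leqnn n)).
  by apply: eq_intdiff => x _; rewrite indE.
apply/esym; apply: (g_sigma_algebra_measure_unique (dual_boxes v') _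
  (fun k => dual_box v' (fun=> - k%:R))).
- by move=> _ [c _ <-]; exact: measurable_dual_box.
- by move=> k; exists (fun=> - k%:R).
- exact: dual_boxes_cover.
- exact: dual_boxes_setI.
- by move=> _ [c _ <-]; have [] := boxE c.
- by move=> k; have [] := boxE (fun=> - k%:R).
- exact: (dual_boxes_generate hv hv').
Qed.
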